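(* For all integers $L,M,a,b$ with $ab\geq 0$, $$\sum_{i=0}^M q^{\frac12 i^2}\begin{bmatrix}L+M-i\\ L\end{bmatrix}\mathcal{T}(L-i,i,a,b)=q^{\frac12 b^2}\,\mathcal{T}(L,M,a+b,b).$$
   Context: The Gaussian polynomial is $\left[\begin{smallmatrix}m+n\\ m\end{smallmatrix}\right]=\prod_{k=1}^m\frac{1-q^{n+k}}{1-q^k}$ if $m,n\in\{0,1,2,\dots\}$ and $0$ otherwise. For integers $L,M,a,b$ the refined $q$-trinomial coefficient is $$\mathcal{T}(L,M,a,b)=\sum_{\substack{n=0\\ n+a+L\ \text{even}}}^{L} q^{\frac12 n^2}\begin{bmatrix}M\\ n\end{bmatrix}\begin{bmatrix}M+b+(L-a-n)/2\\ M+b\end{bmatrix}\begin{bmatrix}M-b+(L+a-n)/2\\ M-b\end{bmatrix}$$ (empty sum, hence $0$, if $L<0$). Identities are in the ring of polynomials in $q^{1/2}$. *)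

(* Defs.v *)
From HB Require Import structures.
From mathcomp Require Import all_boot all_order all_algebra.

Set Implicit Arguments.
Unset Strict Implicit.
Unset Printing Implicit Defensive.

Import Order.TTheory GRing.Theory Num.Theory.

Local Open Scope ring_scope.

(* The ring is Z[q^(1/2)] = {poly int}, whose variable 'X is q^(1/2). *)
Definition q : {poly int} := 'X^2.

(* q ^ (n^2 / 2) for an integer n. *)
Definition qhalfsq (n : int) : {poly int} := 'X^(`|n| ^ 2)%N.

Definition gauss_num (m n : nat) : {poly int} :=
  \prod_(1 <= k < m.+1) (1 - q ^+ (n + k)).

Definition gauss_den (m : nat) : {poly int} :=
  \prod_(1 <= k < m.+1) (1 - q ^+ k).

(* The Gaussian polynomial with top entry t = m + n and bottom entry m.  The
   polynomial quotient is exact: see gauss_numE and gaussE below. *)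
Definition gauss (t m : int) : {poly int} :=
  match m, t - m with
  | Posz m', Posz n' => gauss_num m' n' %/ gauss_den m'
  | _, _ => 0
  end.

(* The natural numbers 0, 1, ..., N; empty when N < 0. *)
Definition upto (N : int) : seq nat :=
  if N is Posz N' then iota 0 N'.+1 else [::].

(* Both divisions by 2 are exact, since n + a + L is even. *)
Definition qtrinomial (L M a b : int) : {poly int} :=
  \sum_(n <- upto L | (2 %| n%:Z + a + L)%Z)
     qhalfsq n%:Z
     * gauss M n%:Z
     * gauss (M + b + ((L - a - n%:Z) %/ 2)%Z) (M + b)
     * gauss (M - b + ((L + a - n%:Z) %/ 2)%Z) (M - b).

Lemma mem_upto (N : int) (n : nat) : (n \in upto N) = (n%:Z <= N).
Proof. by case: N => N //=; rewrite -[0%N :: _]/(iota 0 N.+1) mem_iota. Qed.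

Lemma gauss_den_unit m : lead_coef (gauss_den m) \is a GRing.unit.
Proof.
rewrite /gauss_den lead_coef_prod big_nat; apply: rpred_prod => k /andP[k_gt0 _].
rewrite -opprB lead_coefN unitrN /q -exprM.
by rewrite (monicP (monicXnsubC _ _)) ?unitr1 // muln_gt0.
Qed.

Lemma gauss_den_neq0 m : gauss_den m != 0.
Proof.
by apply: contraTneq (gauss_den_unit m) => ->; rewrite lead_coef0 unitr0.
Qed.

Lemma gauss_num_divides m n : exists p, gauss_num m n = p * gauss_den m.
Proof.
have numS i j : gauss_num i.+1 j = gauss_num i j * (1 - q ^+ (j + i.+1)).
  by rewrite /gauss_num big_nat_recr.
have numS' i j : gauss_num i.+1 j = (1 - q ^+ j.+1) * gauss_num i j.+1.
  rewrite /gauss_num big_nat_recl // addn1; congr (_ * _).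
  by apply: eq_bigr => k _; rewrite addSnnS.
have denS i : gauss_den i.+1 = gauss_den i * (1 - q ^+ i.+1).
  by rewrite /gauss_den big_nat_recr.
elim: m n => [|m IHm] n.
  by exists 1; rewrite /gauss_num /gauss_den !big_geq ?mulr1.
elim: n => [|n [p2 E2]].
  by exists 1; rewrite mul1r; apply: eq_bigr => k _; rewrite add0n.
have [p1 E1] := IHm n.+1.
exists (p1 + q ^+ m.+1 * p2).
rewrite mulrDl -mulrA -E2 (numS' m n) denS mulrA -E1 (numS m n.+1).
have -> : q ^+ (n.+1 + m.+1) = q ^+ m.+1 * q ^+ n.+1 by rewrite addnC exprD.
rewrite mulrA [RHS]addrC [q ^+ m.+1 * _ * _]mulrC -mulrDr; congr (_ * _).
by rewrite mulrBr mulr1 [RHS]addrC addrA subrK.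
Qed.

Lemma gauss_numE (m n : nat) :
  gauss_num m n = gauss (m%:Z + n%:Z) m%:Z * gauss_den m.
Proof.
have [p E] := gauss_num_divides m n.
rewrite /gauss; have -> : m%:Z + n%:Z - m%:Z = n%:Z by rewrite addrAC subrr add0r.
by rewrite E Pdiv.IdomainUnit.mulpK ?gauss_den_unit.
Qed.

Lemma gaussE (m n : nat) :
  tofrac (gauss (m%:Z + n%:Z) m%:Z) =
  \prod_(1 <= k < m.+1) (tofrac (1 - q ^+ (n + k)) / tofrac (1 - q ^+ k)).
Proof.
have fden0 : tofrac (gauss_den m) != 0 by rewrite tofrac_eq0 gauss_den_neq0.
apply: (mulIf fden0); rewrite -rmorphM -gauss_numE big_split /=.
rewrite prodfV -!rmorph_prod -/(gauss_num m n) -/(gauss_den m).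
by rewrite mulfVK.
Qed.

(* Main.v *)
(* Writing n = i - m, the summand on the left is q^((i^2 + (i - m)^2) / 2) times
   [L+M-i; L] [i; m] [A; i+b] [B; i-b], where A and B depend on m only and
   A + B = L + m.  Replacing (a, b) by (-a, -b) swaps the last two factors, so
   one may assume a, b >= 0.  The q-Pfaff-Saalschuetz sum
     sum_k q^((n-k)(x-k)) [x; k] [N-x; n-k] [r+k; N] = [r; N-n] [r+n-N+x; n]
   is then used three times: backwards, to expand [B; i-b] [i; m] as a sum over
   k <= b of [b; k] [B-m; i-m-k] [B+k; B-m+b]; forwards, to evaluate the sum
   over i; and, after grouping the terms by n = m - b + 2k, forwards again to
   evaluate the sum over k.  The intermediate top entry B - m may be negative,
   so the Gaussian coefficients have to be extended to negative tops, which
   brings in negative powers of q; hence the computation takes place in the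
   fraction field. *)
Require Import Defs.
From HB Require Import structures.
From mathcomp Require Import all_boot all_order all_algebra.
From mathcomp Require Import zify ring.
Import Order.TTheory GRing.Theory Num.Theory.
Local Open Scope ring_scope.

(** The nonzero values of [f] occur only at points that both sums reach, and injectivity of [g]
    makes each count once. The bounds [K] and [K'] may therefore be generous. *)
Lemma sum_reindex_int (V : nmodType) (f : int -> V) (g : nat -> int)
    (K K' : nat) :
  injective g ->
  (forall z, f z != 0 -> 0 <= z < K'%:Z /\ exists2 i, (i < K)%N & z = g i) ->
  \sum_(i < K) f (g i) = \sum_(j < K') f j%:Z.
Proof.
move=> g_inj fP.
transitivity (\sum_(i < K) \sum_(j < K' | j%:Z == g i) f j%:Z).
  apply: eq_bigr => i _; have [f0|/fP[/andP[z_ge0 z_lt] _]] := eqVneq (f (g i)) 0.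
    by rewrite f0 big1 // => j /eqP->.
  have lt_z : (`|g i| < K')%N by lia.
  rewrite (big_pred1 (Ordinal lt_z)) => [|j] /=; first by rewrite gez0_abs.
  by rewrite -(inj_eq val_inj) /=; lia.
rewrite (exchange_big_dep xpredT) //=; apply: eq_bigr => j _.
have [->|/fP[_ [i i_lt zE]]] := eqVneq (f j%:Z) 0; first by rewrite big1.
rewrite (big_pred1 (Ordinal i_lt)) // => k.
by rewrite zE (inj_eq g_inj) /= -(inj_eq val_inj) eq_sym.
Qed.

(** * Gaussian coefficients with arbitrary integer top over a field *)

Section Gaussian.

Variables (F : fieldType) (q : F).
Hypothesis q_neq0 : q != 0.
Hypothesis q_nonroot : forall k, q ^+ k.+1 != 1.

Definition qfact (m : nat) : F := \prod_(l < m) (1 - q ^+ l.+1).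

Definition qfall (t : int) (m : nat) : F := \prod_(l < m) (1 - q ^ (t - l%:Z)).

(* Unlike [gauss t m], this does not vanish for t < 0 <= m.  It is locked because
   [mulrA] would otherwise see through [gz t j] to the product behind it. *)
Definition gz : int -> int -> F := locked (fun t m =>
  if m is Posz j then qfall t j / qfact j else 0).

Lemma gzE t (j : nat) : gz t j%:Z = qfall t j / qfact j.
Proof. by rewrite /gz -lock. Qed.

Lemma qfact_neq0 m : qfact m != 0.
Proof. by apply/prodf_neq0 => i _; rewrite subr_eq0 eq_sym q_nonroot. Qed.

Lemma qfallD t m n : qfall t (m + n) = qfall t m * qfall (t - m%:Z) n.
Proof.
rewrite /qfall big_split_ord /=; congr (_ * _).
by apply: eq_bigr => l _; rewrite PoszD opprD addrA.
Qed.

Lemma qfall_fact n : qfall n%:Z n = qfact n.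
Proof.
rewrite /qfall (reindex_inj rev_ord_inj); apply: eq_bigr => l _ /=.
by rewrite exprnP; congr (1 - q ^ _); have := ltn_ord l; lia.
Qed.

Lemma gz_neg t m : m < 0 -> gz t m = 0.
Proof. by rewrite /gz -lock; case: m. Qed.

Lemma gz0 t : gz t 0 = 1.
Proof. by rewrite -[0]/(0%N%:Z) gzE /qfall /qfact !big_ord0 divr1. Qed.

Lemma gz_small t m : 0 <= t -> t < m -> gz t m = 0.
Proof.
case: t m => [t|//] [m|//] _ lt_tm; rewrite gzE /qfall.
have t_lt : (t < m)%N by lia.
by rewrite (bigD1 (Ordinal t_lt)) //= subrr expr0z subrr !mul0r.
Qed.

Lemma gz_fact m n : gz (m + n)%N%:Z m%:Z * (qfact m * qfact n) = qfact (m + n).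
Proof.
rewrite -(qfall_fact (m + n)) qfallD (_ : (m + n)%:Z - m%:Z = n%:Z); last by lia.
by rewrite qfall_fact mulrA gzE divfK ?qfact_neq0.
Qed.

Lemma gz_sym t m : 0 <= t -> gz t m = gz t (t - m).
Proof.
case: t => [t|//] _; have [m0|m0] := ltP m 0.
  by rewrite gz_neg // gz_small //; lia.
have [tm|mt] := ltP t%:Z m.
  by rewrite gz_small // gz_neg //; lia.
case: m m0 mt => [m|//] _ mt.
rewrite -(subnKC (_ : (m <= t)%N)); last by lia.
set n := (t - m)%N; rewrite (_ : (m + n)%:Z - m%:Z = n%:Z); last by lia.
apply: (mulIf (mulf_neq0 (qfact_neq0 m) (qfact_neq0 n))); rewrite gz_fact.
by rewrite addnC -gz_fact [qfact n * _]mulrC.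
Qed.

(** For 0 <= v <= u, clearing the q-factorials leaves the splitting of the falling product of length
    [u] after [v] factors, which is valid for negative [r] too. Otherwise both sides vanish. *)
Lemma gz_revision r u v : gz r u * gz u v = gz r v * gz (r - v) (u - v).
Proof.
case: u => [u|u]; last first.
  rewrite gz_neg // mul0r; case: v => [v|v]; last by rewrite gz_neg ?mul0r.
  by rewrite (@gz_neg _ (_ - _)) ?mulr0 //; lia.
case: v => [v|v]; last by rewrite !(gz_neg _ (Negz _)) // mulr0 mul0r.
have [lt_uv|le_vu] := ltnP u v.
  by rewrite (@gz_small u) ?(@gz_neg _ (_ - _)) ?mulr0 //; lia.
rewrite -(subnKC le_vu); set w := (u - v)%N.
rewrite (_ : (v + w)%:Z - v%:Z = w%:Z); last by lia.
have nz := mulf_neq0 (qfact_neq0 v) (qfact_neq0 w).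
apply: (mulIf nz); rewrite -mulrA gz_fact !gzE divfK ?qfact_neq0 //.
rewrite mulrACA !divfK ?qfact_neq0 //.
exact: qfallD.
Qed.

Lemma gz_revision_sym r u v :
  gz r u * gz u v = gz r (u - v) * gz (r - u + v) v.
Proof.
case: (ltP u 0) => [u0|u0].
  rewrite gz_neg // mul0r; have [v0|v0] := ltP v 0.
    by rewrite (gz_neg _ _ v0) mulr0.
  by rewrite (gz_neg r (u - v)) ?mul0r //; lia.
by rewrite (gz_sym u v) // gz_revision; congr (_ * gz _ _); ring.
Qed.

Lemma gzS t j : gz t j.+1 = gz t j * (1 - q ^ (t - j%:Z)) / (1 - q ^+ j.+1).
Proof.
rewrite !gzE /qfall /qfact !big_ord_recr /= invfM -!mulrA.
by congr (_ * _); rewrite mulrCA.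
Qed.

Lemma gzSS t j : gz (t + 1) j.+1 = gz t j * (1 - q ^ (t + 1)) / (1 - q ^+ j.+1).
Proof.
have fallE : qfall (t + 1) j.+1 = (1 - q ^ (t + 1)) * qfall t j.
  by rewrite -add1n qfallD addrK {1}/qfall big_ord1 subr0.
have factE : qfact j.+1 = qfact j * (1 - q ^+ j.+1).
  by rewrite /qfact big_ord_recr.
by rewrite !gzE fallE factE invfM; ring.
Qed.

(** For m = j + 1 every term is a multiple of [gz t j / (1 - q ^+ j.+1)], and what remains is a
    linear identity between powers of q. *)
Lemma gz_pascal (t m : int) : gz (t + 1) m = gz t m + q ^ (t + 1 - m) * gz t (m - 1).
Proof.
case: m => [[|j]|j]; last by rewrite !gz_neg // mulr0 addr0.
  by rewrite !gz0 gz_neg ?mulr0 ?addr0.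
rewrite gzSS gzS (_ : j.+1%:Z - 1 = j%:Z); last by lia.
rewrite (_ : t + 1 - j.+1%:Z = t - j%:Z); last by lia.
rewrite (_ : t + 1 = t - j%:Z + j.+1%:Z); last by lia.
rewrite expfzDr // -exprnP.
have := q_nonroot j; rewrite eq_sym -subr_eq0; set Q := q ^+ _ => nz.
by field.
Qed.

Lemma gz_pascal' (t m : int) : gz (t + 1) m = q ^ m * gz t m + gz t (m - 1).
Proof.
case: m => [[|j]|j]; last by rewrite !gz_neg // mulr0 addr0.
  by rewrite !gz0 gz_neg ?mulr1 ?addr0.
rewrite gzSS gzS (_ : j.+1%:Z - 1 = j%:Z); last by lia.
rewrite (_ : t + 1 = t - j%:Z + j.+1%:Z); last by lia.
rewrite expfzDr // -exprnP.
have := q_nonroot j; rewrite eq_sym -subr_eq0; set Q := q ^+ _ => nz.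
by field.
Qed.

(** * The q-Chu-Vandermonde and q-Pfaff-Saalschuetz sums *)

Lemma gz0l m : gz 0 m = (m == 0)%:R.
Proof.
have [->|m0] := eqVneq m 0; first exact: gz0.
by case: (ltP m 0) => h; [rewrite gz_neg | rewrite gz_small //; lia].
Qed.

(** Induction on [a]: [gz_pascal] splits both sides, and the second half matches after shifting [l]
    by one. The top [b] may be negative. *)
Lemma vandermonde (a : nat) (b n : int) (K : nat) : n < K%:Z ->
  \sum_(l < K) q ^ (l%:Z * (b - n + l%:Z)) * gz a l%:Z * gz b (n - l%:Z)
  = gz (a%:Z + b) n.
Proof.
elim: a n K => [|a IHa] n [|K] n_lt; try by rewrite big_ord0 gz_neg.
  rewrite big_ord_recl big1 => [|l _]; last by rewrite gz0l mulr0 mul0r.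
  by rewrite gz0l mul0r expr0z !mul1r subr0 !add0r addr0.
rewrite (_ : a.+1%:Z + b = a%:Z + b + 1); last by lia.
rewrite gz_pascal -(IHa n K.+1) // -(IHa (n - 1) K); last by lia.
have aS : a.+1%:Z = a%:Z + 1 by lia.
under eq_bigr => l _ do rewrite aS gz_pascal mulrDr mulrDl.
rewrite big_split /=; congr (_ + _).
rewrite big_ord_recl (@gz_neg _ (0 - 1)) // !mulr0 mul0r add0r mulr_sumr.
apply: eq_bigr => l _; rewrite lift0 -addn1 PoszD addrK !mulrA -!expfzDr //.
by congr (q ^ _ * _ * gz _ _); ring.
Qed.

Lemma vandermonde' (a : nat) (b n : int) (K : nat) : n < K%:Z ->
  \sum_(l < K) q ^ ((n - l%:Z) * (a%:Z - l%:Z)) * gz a l%:Z * gz b (n - l%:Z)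
  = gz (a%:Z + b) n.
Proof.
elim: a n K => [|a IHa] n [|K] n_lt; try by rewrite big_ord0 gz_neg.
  rewrite big_ord_recl big1 => [|l _]; last by rewrite gz0l mulr0 mul0r.
  by rewrite gz0l !subr0 mulr0 expr0z !mul1r add0r addr0.
rewrite (_ : a.+1%:Z + b = a%:Z + b + 1); last by lia.
rewrite gz_pascal' -(IHa n K.+1) // -(IHa (n - 1) K); last by lia.
have aS : a.+1%:Z = a%:Z + 1 by lia.
under eq_bigr => l _ do rewrite aS gz_pascal' mulrDr mulrDl.
rewrite big_split /=; congr (_ + _).
  rewrite mulr_sumr; apply: eq_bigr => l _; rewrite !mulrA -!expfzDr //.
  by congr (q ^ _ * gz _ _ * gz _ _); lia.
rewrite big_ord_recl (@gz_neg _ (0 - 1)) // !mulr0 mul0r add0r.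
apply: eq_bigr => l _; rewrite lift0 -addn1 PoszD addrK.
by congr (q ^ _ * _ * gz _ _); ring.
Qed.

(** Expand [gz (r + k) N] by [vandermonde] into a sum over [l] and exchange the sums. Trinomial
    revision of [gz x k * gz k l] frees [gz x l], and [vandermonde'] evaluates the sum over [k]. A
    second revision leaves a sum over [l] that is again of the form of [vandermonde]. *)
Lemma q_saalschutz (x N : nat) (n r : int) (K : nat) :
  n <= N%:Z -> (N < K)%N ->
  \sum_(k < K) q ^ ((n - k%:Z) * (x%:Z - k%:Z)) * gz x k%:Z
      * gz (N%:Z - x%:Z) (n - k%:Z) * gz (r + k%:Z) N
  = gz r (N%:Z - n) * gz (r + n - N%:Z + x%:Z) n.
Proof.
move=> le_nN lt_NK.
rewrite (_ : r + n - _ + x%:Z = x%:Z + (r + n - N%:Z)); last by lia.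
(* The right-hand side is expanded as well, so that the two sides can be compared term by term in
   [l]. *)
rewrite -(@vandermonde x _ _ K); last by lia.
under eq_bigr => k _ do
  rewrite [r + _]addrC -(@vandermonde k r N K) // mulr_sumr.
rewrite exchange_big mulr_sumr /=; apply: eq_bigr => l _.
(* For l > x both terms vanish; otherwise x - l is a natural number, as [vandermonde'] requires. *)
have [lt_xl|le_lx] := ltnP x l.
  rewrite (@gz_small x l) // mulr0 mul0r mulr0 big1 // => k _.
  have [lt_xk|le_kx] := ltnP x k.
    by rewrite (@gz_small x k) // mulr0 !mul0r.
  by rewrite (@gz_small k l) ?mulr0 ?mul0r ?mulr0 //; lia.
pose f (k : int) := q ^ ((n - k) * (x%:Z - k)) * gz (x%:Z - l%:Z) (k - l%:Z)
  * gz (N%:Z - x%:Z) (n - k).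
transitivity (q ^ (l%:Z * (r - N%:Z + l%:Z)) * gz x l * gz r (N%:Z - l%:Z)
   * \sum_(k < K) f k%:Z).
  rewrite mulr_sumr; apply: eq_bigr => k _; rewrite /f.
  have E := gz_revision x k l.
  transitivity (q ^ ((n - k%:Z) * (x%:Z - k%:Z)) * gz (N%:Z - x%:Z) (n - k%:Z)
    * q ^ (l%:Z * (r - N%:Z + l%:Z)) * gz r (N%:Z - l%:Z) * (gz x k * gz k l)).
    by ring.
  by rewrite E; ring.
have -> : \sum_(k < K) f k%:Z = gz (N%:Z - l%:Z) (n - l%:Z).
  rewrite -(@sum_reindex_int _ f (fun k => k%:Z + l%:Z) K).
  - have xlE : (x - l)%N%:Z = x%:Z - l%:Z by lia.
    rewrite (_ : N%:Z - l%:Z = (x - l)%N%:Z + (N%:Z - x%:Z)); last by lia.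
    rewrite -(@vandermonde' _ _ _ K); last by lia.
    apply: eq_bigr => k _; rewrite /f xlE.
    by congr (q ^ _ * gz _ _ * gz _ _); ring.
  - by move=> i j /addIr[].
  move=> z; rewrite /f; have [lt_zl|le_lz] := ltP z l%:Z.
    by rewrite (@gz_neg _ (z - _)) ?mulr0 ?mul0r ?eqxx //; lia.
  have [lt_nz|le_zn] := ltP n z.
    by rewrite (@gz_neg _ (n - _)) ?mulr0 ?mul0r ?eqxx //; lia.
  by split; [lia | exists `|z - l%:Z|%N; lia].
rewrite -!mulrA gz_revision_sym.
rewrite (_ : N%:Z - l%:Z - (n - l%:Z) = N%:Z - n); last by ring.
rewrite (_ : r - (N%:Z - l%:Z) + (n - l%:Z) = r + n - N%:Z); last by ring.
rewrite (_ : r + n - N%:Z - n = r - N%:Z); last by ring.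
by ring.
Qed.

End Gaussian.

(** * The transformation of the double sum, with s in the role of q^(1/2) *)

Section Transformation.

Variables (F : fieldType) (s : F).
Hypothesis s_neq0 : s != 0.
Hypothesis s_nonroot : forall k, (s ^+ 2) ^+ k.+1 != 1.

Let q := s ^+ 2.

Lemma q_neq0 : q != 0. Proof. exact: expf_neq0. Qed.

Let q_powE (z : int) : q ^ z = s ^ (2 * z).
Proof. by rewrite -exprz_exp. Qed.

(** The convention of [gauss], with zero for negative tops. It differs from [gz] only when t < 0 <=
    m; it gives finite supports, whereas the summation formulas hold for [gz]. *)
Definition gb (t m : int) : F := if 0 <= t then gz F q t m else 0.

Lemma gb_gz (t m : int) : 0 <= t \/ m < 0 -> gb t m = gz F q t m.
Proof.
by rewrite /gb => -[->|m_lt0] //; rewrite gz_neg // if_same.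
Qed.

Lemma gb_supp (t m : int) : gb t m != 0 -> 0 <= m <= t.
Proof.
rewrite /gb; case: ifP => [t0|]; last by rewrite eqxx.
have [m0|m0] := ltP m 0; first by rewrite gz_neg ?eqxx.
by have [tm|//] := ltP t m; rewrite gz_small ?q_neq0 ?eqxx.
Qed.

Variables L M a b : nat.

(* The summand of the left-hand side, with p = (L - i - a - n) / 2. *)
Definition lhs_term (i n p : int) : F :=
  s ^ (i * i + n * n) * gb (L%:Z + M%:Z - i) L%:Z * gb i n
  * gb (i + b%:Z + p) (i + b%:Z) * gb (i - b%:Z + a%:Z + p) (i - b%:Z).

(* The summand of the right-hand side, with v = (L - a - b - n) / 2. *)
Definition rhs_term (n v : int) : F :=
  s ^ (b%:Z * b%:Z + n * n) * gb M%:Z n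
  * gb (M%:Z + b%:Z + v) (M%:Z + b%:Z) * gb (M%:Z + a%:Z + v) (M%:Z - b%:Z).

(** What remains once the sum over [i] is evaluated: [k] is the index of the expansion, and v + k =
    u determines m = L - a - 2u. Fixing u gives the left-hand grouping, fixing [v] the right-hand
    one. *)
Definition mid_term (v k : int) : F :=
  let m := L%:Z - a%:Z - 2 * (v + k) in
  s ^ (m * m + 2 * (k * (m + k))) * gb b%:Z k
  * gb (L%:Z - b%:Z - v) (v + k + a%:Z)
  * gb (M%:Z + b%:Z + v) v * gb (M%:Z + v + k + a%:Z) (L%:Z - v).

Lemma lhs_term_supp i n p : lhs_term i n p != 0 ->
  [/\ 0 <= i <= M%:Z, 0 <= n <= i, 0 <= p, b%:Z <= i & 0 <= a%:Z + p].
Proof.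
rewrite /lhs_term !mulf_eq0 !negb_or => /andP[/andP[/andP[/andP[_ h1] h2] h3] h4].
move/gb_supp in h1; move/gb_supp in h2; move/gb_supp in h3; move/gb_supp in h4.
by split; lia.
Qed.

Lemma mid_term_supp v k : mid_term v k != 0 ->
  [/\ 0 <= k <= b%:Z, 0 <= v & 2 * v + k + a%:Z + b%:Z <= L%:Z].
Proof.
rewrite /mid_term /= !mulf_eq0 !negb_or.
move=> /andP[/andP[/andP[/andP[_ h1] h2] h3] h4].
move/gb_supp in h1; move/gb_supp in h2; move/gb_supp in h3.
by split; lia.
Qed.

(** At fixed [u] the difference m of the first two arguments of [lhs_term] is constant, so that
    summing over [j] is summing over [i] at fixed m. *)
Lemma lhs_mid (u K : nat) : (L < K)%N ->
  \sum_(j < K) lhs_term (L%:Z - a%:Z - u%:Z - j%:Z) (u%:Z - j%:Z) j%:Z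
  = \sum_(k < K) mid_term (u%:Z - k%:Z) k%:Z.
Proof.
(* These are the conditions m >= 0 and B >= 0, where B = L - b - u. If one fails, all terms on both
   sides vanish. *)
move=> LK; have [/andP[u_le1 u_le2]|out] :=
  boolP ((2 * u + a <= L) && (u + b <= L))%N; last first.
  rewrite big1 => [|j _]; last first.
    apply: contraNeq out => h; move: (h) => /lhs_term_supp[*].
    move: h; rewrite /lhs_term !mulf_eq0 !negb_or => /andP[_ /gb_supp].
    by lia.
  rewrite big1 // => k _.
  by apply: contraNeq out => /mid_term_supp[*]; lia.
pose m : int := L%:Z - a%:Z - 2 * u%:Z.
pose A := (L - a + b - u)%N.
have AE : A%:Z = L%:Z - a%:Z + b%:Z - u%:Z by rewrite /A; lia.
transitivity (\sum_(j < K) \sum_(k < K)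
  (s ^ (m * m + 2 * (k%:Z * (m + k%:Z)))
   * gz F q b k%:Z * gz F q (L%:Z - b%:Z - u%:Z + k%:Z) (u + a)%N)
  * (q ^ ((u%:Z - k%:Z - j%:Z) * (A%:Z - j%:Z)) * gz F q A j%:Z
    * gz F q (L%:Z - A%:Z) (u%:Z - k%:Z - j%:Z)
    * gz F q (M%:Z + u%:Z + a%:Z + j%:Z) L)).
  apply: eq_bigr => j _; rewrite /lhs_term.
  have [lt_uj|le_ju] := ltnP u j.
    have t_lt0 : u%:Z - j%:Z < 0 by lia.
    rewrite (@gb_gz _ (u%:Z - _)); last by right.
    rewrite [gz _ _ _ (u%:Z - _)]gz_neg // mulr0 !mul0r big1 // => k _.
    by rewrite (@gz_neg _ _ (L%:Z - _)) ?mulr0 ?mul0r ?mulr0 //; lia.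
  set i : int := L%:Z - a%:Z - u%:Z - j%:Z; pose t : int := u%:Z - j%:Z.
  have iE : i = L%:Z - a%:Z - u%:Z - j%:Z by [].
  have tE : t = u%:Z - j%:Z by [].
  rewrite -/t !gb_gz; try by left; lia.
  (* [q_saalschutz] read backwards with x = b, N = u + a, n = t and r = L - b - u, after symmetry
     has turned the lower entry i - b into a + j. The top u + a - b may be negative here. *)
  have expand : gz F q i t * gz F q (i - b%:Z + a%:Z + j%:Z) (i - b%:Z) =
    \sum_(k < K) q ^ ((t - k%:Z) * (b%:Z - k%:Z)) * gz F q b k%:Z
     * gz F q ((u + a)%N%:Z - b%:Z) (t - k%:Z)
     * gz F q (L%:Z - b%:Z - u%:Z + k%:Z) (u + a)%N.
    rewrite q_saalschutz ?q_neq0 //; [|lia|lia].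
    rewrite mulrC [gz F q (_ + j%:Z) _]gz_sym ?q_neq0 //; last by lia.
    by congr (gz _ _ _ _ * gz _ _ _ _); lia.
  transitivity (s ^ (i * i + t * t) * gz F q (L%:Z + M%:Z - i) L
     * gz F q (i + b%:Z + j%:Z) (i + b%:Z)
     * (gz F q i t * gz F q (i - b%:Z + a%:Z + j%:Z) (i - b%:Z))); first by ring.
  rewrite expand mulr_sumr; apply: eq_bigr => k _.
  have -> : gz F q (i + b%:Z + j%:Z) (i + b%:Z) = gz F q A j.
    by rewrite gz_sym ?q_neq0 //; [congr (gz _ _ _ _)|]; lia.
  have -> : L%:Z + M%:Z - i = M%:Z + u%:Z + a%:Z + j%:Z by lia.
  have -> : (u + a)%N%:Z - b%:Z = L%:Z - A%:Z by lia.
  have -> : u%:Z - k%:Z - j%:Z = t - k%:Z by lia.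
  (* Since i = m + t and A - j = i + b, the weight of the expansion turns into the weight needed for
     the sum over [j], up to a factor free of [j]. *)
  have expE : s ^ (i * i + t * t) * q ^ ((t - k%:Z) * (b%:Z - k%:Z)) =
      s ^ (m * m + 2 * (k%:Z * (m + k%:Z))) * q ^ ((t - k%:Z) * (A%:Z - j%:Z)).
    rewrite !q_powE -!expfzDr //; congr (s ^ _).
    by rewrite AE iE tE /m; ring.
  transitivity (s ^ (i * i + t * t) * q ^ ((t - k%:Z) * (b%:Z - k%:Z))
     * (gz F q (M%:Z + u%:Z + a%:Z + j%:Z) L * gz F q A j * gz F q b k%:Z
        * gz F q (L%:Z - A%:Z) (t - k%:Z)
        * gz F q (L%:Z - b%:Z - u%:Z + k%:Z) (u + a)%N)); first by ring.
  by rewrite expE; ring.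
rewrite exchange_big /=; apply: eq_bigr => k _.
rewrite -mulr_sumr q_saalschutz ?q_neq0 //; [|lia].
rewrite /mid_term /= !gb_gz; try by [left; lia]; last first.
  (* For k > u the top M + b + u - k may be negative, but then the lower entry u - k is negative
     too. *)
  by have [|] := leP k%:Z u%:Z; [left|right]; lia.
rewrite (_ : u%:Z - k%:Z + k%:Z = u%:Z); last by ring.
rewrite -/m.
rewrite (_ : L%:Z - b%:Z - (u%:Z - k%:Z) = L%:Z - b%:Z - u%:Z + k%:Z); last by ring.
rewrite (_ : M%:Z + (u%:Z - k%:Z) + k%:Z + a%:Z = M%:Z + u%:Z + a%:Z); last by ring.
rewrite (_ : M%:Z + u%:Z + a%:Z + (u%:Z - k%:Z) - L%:Z + A%:Z =
  M%:Z + b%:Z + (u%:Z - k%:Z)); last by rewrite AE; ring.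
rewrite PoszD; ring.
Qed.

(** After symmetry turns the lower entry v + k + a into n - k, this is [q_saalschutz] with x = b, N
    = L - v and r = M + a + v. *)
Lemma mid_rhs (v K : nat) : (L < K)%N ->
  \sum_(k < K) mid_term v%:Z k%:Z = rhs_term (L%:Z - a%:Z - b%:Z - 2 * v%:Z) v%:Z.
Proof.
move=> LK; set n : int := L%:Z - a%:Z - b%:Z - 2 * v%:Z.
have nE : n = L%:Z - a%:Z - b%:Z - 2 * v%:Z by [].
have [n_lt0|n_ge0] := ltP n 0.
  rewrite /rhs_term [gb _ n]gb_gz ?gz_neg ?mulr0 ?mul0r; [|by []|by right].
  rewrite big1 // => k _.
  by apply/eqP; apply: contraTT n_lt0 => /mid_term_supp[*]; lia.
have vL : (v <= L)%N by lia.
have LvE : (L - v)%N%:Z = L%:Z - v%:Z by lia.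
transitivity (\sum_(k < K) (s ^ (b%:Z * b%:Z + n * n)
   * gb (M%:Z + b%:Z + v%:Z) (M%:Z + b%:Z))
   * (q ^ ((n - k%:Z) * (b%:Z - k%:Z)) * gz F q b k%:Z
    * gz F q ((L - v)%N%:Z - b%:Z) (n - k%:Z)
    * gz F q (M%:Z + a%:Z + v%:Z + k%:Z) (L - v)%N)).
  apply: eq_bigr => k _; rewrite /mid_term /= !gb_gz; try by left; lia.
  rewrite LvE q_powE [gz F q (L%:Z - b%:Z - v%:Z) _]gz_sym ?q_neq0 //; last by lia.
  rewrite [gz F q (M%:Z + b%:Z + v%:Z) v]gz_sym ?q_neq0 //.
  set e := _ + 2 * (_ * _).
  have -> : e = b%:Z * b%:Z + n * n + 2 * ((n - k%:Z) * (b%:Z - k%:Z)).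
    by rewrite /e nE; ring.
  rewrite expfzDr //.
  rewrite (_ : L%:Z - b%:Z - v%:Z - (v%:Z + k%:Z + a%:Z) = n - k%:Z);
    last by rewrite nE; ring.
  rewrite (_ : M%:Z + b%:Z + v%:Z - v%:Z = M%:Z + b%:Z); last by ring.
  rewrite (_ : M%:Z + v%:Z + k%:Z + a%:Z = M%:Z + a%:Z + v%:Z + k%:Z); last by ring.
  rewrite (_ : L%:Z - b%:Z - v%:Z = L%:Z - v%:Z - b%:Z); last by ring.
  by ring.
rewrite -mulr_sumr q_saalschutz ?q_neq0 //; [|lia|lia].
rewrite /rhs_term !gb_gz; try by left; lia.
rewrite [gz F q (M%:Z + a%:Z + v%:Z) (M%:Z - _)]gz_sym ?q_neq0 //.
rewrite (_ : M%:Z + a%:Z + v%:Z - (M%:Z - b%:Z) = (L - v)%N%:Z - n); last by lia.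
rewrite (_ : M%:Z + a%:Z + v%:Z + n - (L - v)%N%:Z + b%:Z = M); last by lia.
by ring.
Qed.

(** Only reindexing is left: p to u = L - a - i - p at fixed [i], then i to j = L - a - u - i at
    fixed u, then u to v = u - k at fixed k. The supports keep all these indices below [K]. *)
Lemma lhs_rhs (K : nat) : (L < K)%N ->
  \sum_(i < M.+1) \sum_(p < K)
     lhs_term i%:Z (L%:Z - i%:Z - a%:Z - 2 * p%:Z) p%:Z
  = \sum_(v < K) rhs_term (L%:Z - a%:Z - b%:Z - 2 * v%:Z) v%:Z.
Proof.
move=> LK.
transitivity (\sum_(i < M.+1) \sum_(u < K)
   lhs_term i%:Z (i%:Z - L%:Z + a%:Z + 2 * u%:Z) (L%:Z - a%:Z - i%:Z - u%:Z)).
  apply: eq_bigr => i _.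
  rewrite -(@sum_reindex_int _
    (fun p => lhs_term i%:Z (L%:Z - i%:Z - a%:Z - 2 * p) p)
    (fun u => L%:Z - a%:Z - i%:Z - u%:Z) K).
  - by apply: eq_bigr => u _; congr (lhs_term _ _ _); lia.
  - by move=> x y; lia.
  move=> p /lhs_term_supp[? ? ? ? ?]; split; first by lia.
  by exists (absz (L%:Z - a%:Z - i%:Z - p)%R); lia.
rewrite exchange_big /=.
transitivity (\sum_(u < K) \sum_(k < K) mid_term (u%:Z - k%:Z) k%:Z).
  apply: eq_bigr => u _; rewrite -lhs_mid //.
  rewrite -(@sum_reindex_int _
    (fun i => lhs_term i (i - L%:Z + a%:Z + 2 * u%:Z) (L%:Z - a%:Z - i - u%:Z))
    (fun j => L%:Z - a%:Z - u%:Z - j%:Z) K).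
  - by apply: eq_bigr => j _; congr (lhs_term _ _ _); lia.
  - by move=> x y; lia.
  move=> i /lhs_term_supp[? ? ? ? ?]; split; first by lia.
  by exists (absz (L%:Z - a%:Z - u%:Z - i)%R); lia.
under [RHS]eq_bigr => v _ do rewrite -(@mid_rhs v K) //.
rewrite exchange_big [RHS]exchange_big /=; apply: eq_bigr => k _.
rewrite -(@sum_reindex_int _ (fun v => mid_term v k%:Z)
  (fun u => u%:Z - k%:Z) K) //.
- by move=> x y; lia.
move=> v /mid_term_supp[? ? ?]; split; first by lia.
by exists (absz (v + k%:Z)%R); lia.
Qed.

End Transformation.

(** * Transfer to polynomials in q^(1/2) through their fraction field *)

#[local] Arguments gauss : simpl never.

Local Notation qh := (tofrac ('X : {poly int})).

Lemma qh_neq0 : qh != 0.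
Proof. by rewrite tofrac_eq0 polyX_eq0. Qed.

Lemma qh_nonroot k : (qh ^+ 2) ^+ k.+1 != 1.
Proof.
rewrite -exprM -rmorphXn -tofrac1 tofrac_eq.
by rewrite -subr_eq0 -size_poly_eq0 size_XnsubC.
Qed.

Lemma tofrac_q : tofrac q = qh ^+ 2.
Proof. by rewrite /q rmorphXn. Qed.

Lemma tofrac_qhalfsq n : tofrac (qhalfsq n) = qh ^ (n * n).
Proof. by rewrite /qhalfsq rmorphXn exprnP; congr (qh ^ _); lia. Qed.

Lemma gauss0 (t m : int) : m < 0 \/ t < m -> gauss t m = 0.
Proof.
rewrite /gauss; case: m => [m|m] //= out.
by case E: (t - m%:Z) => [n|n] //; lia.
Qed.

(** For 0 <= m <= t, multiplying by the denominator leaves the same product on both sides, with its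
    factors in opposite orders. Elsewhere both sides are zero. *)
Lemma tofrac_gauss t m : tofrac (gauss t m) = gb _ qh t m.
Proof.
rewrite /gauss; case: m => [m|m]; last first.
  by rewrite rmorph0 gb_gz ?gz_neg //; right.
case E: (t - m%:Z) => [n|n]; last first.
  rewrite rmorph0; apply/esym/eqP.
  by apply: contraT => /(gb_supp _ _ qh_neq0); lia.
have {E}-> : t = m%:Z + n%:Z by lia.
have -> : (gauss_num m n %/ gauss_den m) = gauss (m%:Z + n%:Z) m%:Z.
  by rewrite /gauss (_ : m%:Z + n%:Z - m%:Z = n%:Z) //; lia.
have den0 : tofrac (gauss_den m) != 0 by rewrite tofrac_eq0 gauss_den_neq0.
apply: (mulIf den0); rewrite -rmorphM -gauss_numE gb_gz ?gzE; last by left; lia.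
have -> : tofrac (gauss_den m) = qfact _ (qh ^+ 2) m.
  rewrite /gauss_den big_add1 big_mkord rmorph_prod; apply: eq_bigr => l _.
  by rewrite rmorphB rmorph1 rmorphXn /= tofrac_q.
rewrite divfK; last exact: qfact_neq0 qh_nonroot _.
rewrite /gauss_num big_add1 /= big_mkord rmorph_prod /qfall.
rewrite (reindex_inj rev_ord_inj).
apply: eq_bigr => l _ /=; rewrite rmorphB rmorph1 rmorphXn /= tofrac_q exprnP.
by congr (1 - _ ^ _); have := ltn_ord l; lia.
Qed.

(** Substituting n = L - a - 2p removes the parity condition and both halvings. As a >= 0, a term
    with n >= 0 has p <= L < K. *)
Lemma qtrinomial_half_sum (L M a b : int) (K : nat) : 0 <= a -> L < K%:Z ->
  qtrinomial L M a b = \sum_(p < K)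
     qhalfsq (L - a - 2 * p%:Z) * gauss M (L - a - 2 * p%:Z)
     * gauss (M + b + p%:Z) (M + b) * gauss (M - b + a + p%:Z) (M - b).
Proof.
move=> a_ge0 LK; rewrite /qtrinomial; case: L LK => [L|L] LK; last first.
  by rewrite big_nil big1 // => p _; rewrite (@gauss0 M) ?mulr0 ?mul0r //; lia.
rewrite -[upto _]/(index_iota 0 L.+1) big_mkord big_mkcond /=.
pose f (n : int) := if (2 %| n + a + L%:Z)%Z then
  qhalfsq n * gauss M n
  * gauss (M + b + ((L%:Z - a - n) %/ 2)%Z) (M + b)
  * gauss (M - b + ((L%:Z + a - n) %/ 2)%Z) (M - b) else 0.
rewrite -(@sum_reindex_int _ f (fun p => L%:Z - a - 2 * p%:Z) K).
- apply: eq_bigr => p _; rewrite /f.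
  have -> : (2 %| L%:Z - a - 2 * p%:Z + a + L%:Z)%Z.
    by apply/dvdzP; exists (L%:Z - p%:Z); ring.
  have -> : ((L%:Z - a - (L%:Z - a - 2 * p%:Z)) %/ 2)%Z = p%:Z.
    by rewrite (_ : L%:Z - a - _ = p%:Z * 2) ?mulzK //; ring.
  have -> : ((L%:Z + a - (L%:Z - a - 2 * p%:Z)) %/ 2)%Z = a + p%:Z.
    by rewrite (_ : L%:Z + a - _ = (a + p%:Z) * 2) ?mulzK //; ring.
  by rewrite !addrA.
- by move=> x y; lia.
move=> n; rewrite /f; case: ifP => [/dvdzP[d dE]|]; last by rewrite eqxx.
have -> : ((L%:Z - a - n) %/ 2)%Z = L%:Z - d.
  by rewrite (_ : L%:Z - a - _ = (L%:Z - d) * 2) ?mulzK //; lia.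
have [n_lt0|n_ge0] := ltP n 0.
  by rewrite (@gauss0 M) ?mulr0 ?mul0r ?eqxx //; left.
(* Here p = L - d; for p < 0 the top entry M + b + p is smaller than M + b. *)
have [d_gt|d_le] := ltP L%:Z d.
  by rewrite (@gauss0 (M + b + _)) ?mulr0 ?mul0r ?eqxx //; right; lia.
by split; [lia|exists (absz (L%:Z - d)%R); lia].
Qed.

Lemma qtrinomialN (L M a b : int) :
  qtrinomial L M (- a) (- b) = qtrinomial L M a b.
Proof.
rewrite /qtrinomial; apply: eq_big => [n|n _].
  apply/dvdzP/dvdzP => -[d dE]; [exists (d + a)|exists (d - a)]; lia.
by rewrite !opprK mulrAC.
Qed.

(** The embedding into the fraction field is injective, and there [lhs_rhs] applies once both
    trinomials are written as sums over p up to [L]. *)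
Lemma theorem2p1_nat (L M a b : nat) :
  \sum_(i <- upto M%:Z)
     qhalfsq i%:Z * gauss (L%:Z + M%:Z - i%:Z) L
       * qtrinomial (L%:Z - i%:Z) i%:Z a b
  = qhalfsq b * qtrinomial L M (a%:Z + b%:Z) b.
Proof.
apply/eqP; rewrite -tofrac_eq; apply/eqP.
rewrite -[upto _]/(index_iota 0 M.+1) big_mkord.
rewrite rmorph_sum rmorphM.
rewrite (@qtrinomial_half_sum L M (a%:Z + b%:Z) b L.+1) //; last by lia.
rewrite rmorph_sum mulr_sumr /=.
have := @lhs_rhs _ _ qh_neq0 qh_nonroot L M a b L.+1 (ltnSn L).
have -> : \sum_(v < L.+1) rhs_term _ qh M a b (L%:Z - a%:Z - b%:Z - 2 * v%:Z) v%:Z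
  = \sum_(v < L.+1) tofrac (qhalfsq b) * tofrac
     (qhalfsq (L%:Z - (a%:Z + b%:Z) - 2 * v%:Z)
     * gauss M (L%:Z - (a%:Z + b%:Z) - 2 * v%:Z)
     * gauss (M%:Z + b%:Z + v%:Z) (M%:Z + b%:Z)
     * gauss (M%:Z - b%:Z + (a%:Z + b%:Z) + v%:Z) (M%:Z - b%:Z)).
  apply: eq_bigr => v _; rewrite /rhs_term !tofracM !tofrac_qhalfsq !tofrac_gauss.
  rewrite expfzDr ?qh_neq0 // -!mulrA opprD !addrA.
  by congr (_ * (_ * (_ * (_ * gb _ _ _ _)))); ring.
move=> <-; apply: eq_bigr => i _.
rewrite (@qtrinomial_half_sum _ _ a b L.+1) //; last by lia.
rewrite tofracM rmorph_sum mulr_sumr; apply: eq_bigr => p _.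
rewrite /= !tofracM !tofrac_qhalfsq !tofrac_gauss /lhs_term expfzDr ?qh_neq0 //.
have regroup (F : fieldType) (x1 x2 y1 y2 y3 y4 : F) :
    x1 * x2 * (y1 * y2 * y3 * y4) = x1 * y1 * x2 * y2 * y3 * y4 by ring.
exact: regroup.
Qed.

Theorem theorem2p1 (L M a b : int) (hab : 0 <= a * b) :
  \sum_(i <- upto M)
     qhalfsq i%:Z * gauss (L + M - i%:Z) L * qtrinomial (L - i%:Z) i%:Z a b
  = qhalfsq b * qtrinomial L M (a + b) b.
Proof.
(* For M < 0 the left sum is empty, and on the right each [gauss M n] vanishes because n > M. *)
case: M => [M|M]; last first.
  rewrite big_nil /qtrinomial big1 ?mulr0 // => n _.
  by rewrite (@gauss0 (Negz M)) ?mulr0 ?mul0r //; right.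
case: L => [L|L]; last first.
  rewrite /qtrinomial big_nil mulr0 big1 // => i _.
  by rewrite gauss0 ?mulr0 ?mul0r //; left.
wlog [a_ge0 b_ge0] : a b hab / 0 <= a /\ 0 <= b => [wlog_ge0|].
  have [ge0|le0] : (0 <= a /\ 0 <= b) \/ (0 <= - a /\ 0 <= - b) by nia.
    exact: wlog_ge0.
  have := wlog_ge0 (- a) (- b).
  rewrite mulrNN -opprD qtrinomialN => /(_ hab le0).
  rewrite (_ : qhalfsq (- b) = qhalfsq b) => [<-|];
    last by rewrite /qhalfsq abszN.
  by apply: eq_bigr => i _; rewrite qtrinomialN.
by case: a b a_ge0 b_ge0 {hab} => [a|//] [b|//] _ _; apply: theorem2p1_nat.
Qed.
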